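(* Consider the initial value problem (P) for a $p$-dimensional system of functional differential equations of order $n$ described in the context, and assume: (i) the functions $f_j$, $j=1,\dots,p$, are analytic in $[0,T^*]\times\mathbb{R}^{np}\times\mathbb{R}^{\omega p}$; (ii) the problem (P) has a unique solution $\mathbf{u}$ on the interval $[0,T^*]$. Let $0<\gamma\le T^*$, $J=[0,\gamma]$, let $\mathbf{u}$ be analytic on $J$, let $\mathbf{U}(k)=(U_1(k),\dots,U_p(k))^T=\frac{1}{k!}\mathbf{u}^{(k)}(0)$ be the components of the differential transformation of $\mathbf{u}$ at $t_0=0$, and put $\mathbf{F}_k(t)=\mathbf{U}(k)t^k$ for $k\ge 0$. Suppose there exist a constant $\delta$ with $0<\delta<1$ and $k_0\in\mathbb{N}$ such that $\|\mathbf{F}_{k+1}(t)\|\le\delta\|\mathbf{F}_k(t)\|$ for all $k\ge k_0$, where $\|\cdot\|$ is the norm of $C^n(J)$ given in the context. Then for the truncated series $\sum_{k=0}^m\mathbf{F}_k(t)$ the following error estimate holds for any $m_0\ge 0$ and $m\ge m_0$: $$\Bigl\|\mathbf{u}(t)-\sum_{k=0}^m\mathbf{F}_k(t)\Bigr\|\le\frac{1}{1-\delta}\,\delta^{m-m_0+1}\max_{i=1,\dots,p}\ \max_{j=0,\dots,n}\left|\frac{m_0!}{(m_0-j)!}\,U_i(m_0)\,\gamma^{m_0-j}\right|,$$ where the terms with $j>m_0$ are read as $0$.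
   Context: Setting. Let $n,p,r\in\mathbb{N}$ and let $m_1,\dots,m_r$ be nonnegative integers with $m_i\le n$. Consider the system $$\mathbf{u}^{(n)}(t)=\mathbf{f}\bigl(t,\mathbf{u}(t),\mathbf{u}'(t),\dots,\mathbf{u}^{(n-1)}(t),\mathbf{u}_1(\alpha_1(t)),\dots,\mathbf{u}_r(\alpha_r(t))\bigr),$$ where $\mathbf{u}=(u_1,\dots,u_p)^T$ is the unknown, $\mathbf{f}=(f_1,\dots,f_p)^T$, $\mathbf{u}_i(\alpha_i(t))=(\mathbf{u}(\alpha_i(t)),\mathbf{u}'(\alpha_i(t)),\dots,\mathbf{u}^{(m_i)}(\alpha_i(t)))$ for $i=1,\dots,r$, and $f_j:[0,\infty)\times\mathbb{R}^{np}\times\mathbb{R}^{\omega p}\to\mathbb{R}$ are continuous, with $\omega=\sum_{i=1}^r(m_i+1)$. Each delayed argument $\alpha_i$ is of one of three types: (1) $\alpha_i(t)=q_it$ with $q_i\in(0,1)$; (2) $\alpha_i(t)=t-\tau_i$ with a real constant $\tau_i>0$; (3) $\alpha_i(t)=t-\tau_i(t)$ with a real function $\tau_i$ satisfying $\tau_i(t)\ge\tau_{i0}>0$ for $t>0$. Let $t^*=\min_{1\le i\le r}\{\inf_{t>0}\alpha_i(t)\}\le 0$. The initial conditions are $\mathbf{u}(0)=\mathbf{v}_0,\ \mathbf{u}'(0)=\mathbf{v}_1,\dots,\mathbf{u}^{(n-1)}(0)=\mathbf{v}_{n-1}$ with given vectors $\mathbf{v}_k\in\mathbb{R}^p$. If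 $t^*<0$, there is also given an initial vector function $\Phi=(\phi_1,\dots,\phi_p)^T$ on $[t^*,0]$ with $\phi_j\in C^n([t^*,0],\mathbb{R})$, satisfying $\Phi(0)=\mathbf{u}(0),\dots,\Phi^{(n-1)}(0)=\mathbf{u}^{(n-1)}(0)$, and one requires $\mathbf{u}=\Phi$ on $[t^*,0]$ (so $\mathbf{u}$ and its derivatives at negative arguments $\alpha_i(t)$ are those of $\Phi$). This is problem (P); $T^*>0$ denotes the right endpoint of the interval on which it is considered. Differential transformation. For an analytic function $\mathbf{u}$, the $k$th component of its differential transformation at $0$ is $\mathbf{U}(k)=\frac{1}{k!}\mathbf{u}^{(k)}(0)\in\mathbb{R}^p$. Here analyticity on $J=[0,\gamma]$ and derivatives at $0$ refer to the restriction of the solution $\mathbf{u}$ to $J$ (one-sided at the endpoints). Norm. $C^n(J)$ is the Banach space of vector-valued functions $\mathbf{h}=(h_1,\dots,h_p)^T$ on $J$ with continuous derivatives up to order $n$, with norm $\|\mathbf{h}\|=\max_{i=1,\dots,p}\max_{j=0,\dots,n}\max_{t\in J}|h_i^{(j)}(t)|$.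
   Formalization: The estimate is proved for m_0 ≥ k_0 (and m ≥ m_0) rather than for any m_0 ≥ 0; for m_0 < k_0 it is false, e.g. u'(t)=1, u(0)=0, γ=1, k_0=1, m_0=m=0 gives left side 1 and right side 0. *)

(* Defs.v *)
From mathcomp Require Export all_boot all_order all_algebra.
From mathcomp Require Export all_classical all_reals all_analysis.
Export Order.TTheory GRing.Theory Num.Theory.
Export numFieldNormedType.Exports.

Global Set Implicit Arguments.
Global Unset Strict Implicit.
Global Unset Printing Implicit Defensive.

#[global] Open Scope classical_set_scope.
#[global] Open Scope ring_scope.

Section Calculus.
Context {R : realType}.
Implicit Types (D : set R) (h : R -> R).

(* Derivatives are relative to a domain D, so they are one-sided at the
   endpoints of a closed interval and ignore the values of h outside D.       *)
Definition diff_quot h t : R -> R := fun s => (h s - h t) / (s - t).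

Definition derivable_in D h t : Prop := cvg (diff_quot h t @ within D t^').

Definition deriv_in D h : R -> R := fun t => lim (diff_quot h t @ within D t^').

Definition derivn_in D k h : R -> R := iter k (deriv_in D) h.

Definition Cn_scalar n D h : Prop :=
  (forall k t, (k < n)%N -> D t -> derivable_in D (derivn_in D k h) t) /\
  (forall k, (k <= n)%N -> {within D, continuous (derivn_in D k h)}).

Definition analytic1 D h : Prop :=
  forall t0, D t0 -> exists c : nat -> R, exists2 rho : R, 0 < rho &
    forall t, D t -> `|t - t0| < rho ->
      series (fun k => c k * (t - t0) ^+ k) @ \oo --> h t.

Section Vector.
Context {p : nat}.
Implicit Types u : R -> 'cV[R]_p.

Definition cmp u (i : 'I_p) : R -> R := fun t => u t i ord0.

Definition Cn n D u : Prop := forall i, Cn_scalar n D (cmp u i).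

Definition analytic D u : Prop := forall i, analytic1 D (cmp u i).

Definition vderivn D k u (t : R) : 'cV[R]_p :=
  \col_i derivn_in D k (cmp u i) t.

Definition jet D k u (t : R) : 'M[R]_(p, k) :=
  \matrix_(i < p, l < k) derivn_in D l (cmp u i) t.

(* The inner maximum over t is written as a supremum; on C^n functions and a
   compact D it is attained.  All terms are nonnegative, so starting the outer
   maxima at 0 is harmless.                                                   *)
Definition Cn_norm n D u : R :=
  \big[Num.max/0]_(i < p) \big[Num.max/0]_(j < n.+1)
    sup [set `|derivn_in D j (cmp u i) t| | t in D].

End Vector.

(* Real-analyticity on a set of a function of finitely many real variables:
   V has coordinates coord i, i : I, and f is near each point x0 of D the sum
   on D of an absolutely convergent power series in the variables
   coord i x - coord i x0, its terms being grouped by total degree.           *)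
Section Multivariate.
Context {I : finType} {V : Type}.

Definition homog_part (c : (I -> nat) -> R) (k : nat) (y : I -> R) : R :=
  \sum_(nu : {ffun I -> 'I_k.+1} | (\sum_i nu i == k)%N)
    c (fun i => nu i) * \prod_i y i ^+ nu i.

Definition analytic_on (coord : I -> V -> R) (D : set V) (f : V -> R) : Prop :=
  forall x0, D x0 -> exists c : (I -> nat) -> R, exists2 rho : R, 0 < rho &
    cvgn (series (fun k => homog_part (fun nu => `|c nu|) k (fun=> rho))) /\
    forall x, D x -> (forall i, `|coord i x - coord i x0| < rho) ->
      series (fun k => homog_part c k (fun i => coord i x - coord i x0)) @ \oo
        --> f x.

End Multivariate.
End Calculus.

Section Problem.
Context {R : realType} {n p r : nat}.
Variable m : 'I_r -> nat.

(* Columns: u, u', ..., u^(n-1) in the first matrix, and the concatenation of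
   the r blocks u(alpha_i), ..., u^(m_i)(alpha_i) in the second one.          *)
Definition args : Type :=
  (R * 'M[R]_(p, n) * 'M[R]_(p, \sum_(i < r) (m i).+1))%type.

Definition rhs : Type :=
  R -> 'M[R]_(p, n) -> 'M[R]_(p, \sum_(i < r) (m i).+1) -> 'cV[R]_p.

Definition arg_index : finType :=
  (unit + 'I_p * 'I_n + 'I_p * 'I_(\sum_(i < r) (m i).+1))%type.

Definition arg_coord (k : arg_index) (x : args) : R :=
  match k with
  | inl (inl _) => x.1.1
  | inl (inr (i, j)) => x.1.2 i j
  | inr (i, j) => x.2 i j
  end.

Definition rhs_cmp (f : rhs) (j : 'I_p) (x : args) : R :=
  f x.1.1 x.1.2 x.2 j ord0.

Definition rhs_continuous (f : rhs) : Prop :=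
  forall j, {within [set x : args | 0 <= x.1.1], continuous (rhs_cmp f j)}.

Definition rhs_analytic (f : rhs) (Tend : R) : Prop :=
  forall j, analytic_on arg_coord [set x : args | 0 <= x.1.1 <= Tend]
                        (rhs_cmp f j).

Variant delayed_argument (a : R -> R) : Prop :=
| Proportional q of 0 < q < 1 & (forall t, 0 <= t -> a t = q * t)
| Constant tau of 0 < tau & (forall t, 0 <= t -> a t = t - tau)
| TimeDependent (tau : R -> R) tau0 of 0 < tau0
    & (forall t, 0 < t -> tau0 <= tau t) & (forall t, 0 <= t -> a t = t - tau t).

Section Data.
Variables (f : rhs) (alpha : 'I_r -> R -> R).
Variables (v : 'I_n -> 'cV[R]_p) (Phi : R -> 'cV[R]_p).

(* Extended-real valued because a time-dependent delay may be unbounded; the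
   history interval is then ]-oo, 0].                                         *)
Definition tstar : \bar R :=
  \big[Order.min/+oo%E]_(i < r)
    ereal_inf [set (alpha i t)%:E | t in `]0, +oo[].

Definition history : set R := [set s | (tstar <= s%:E)%E /\ s <= 0].

Definition initial_function : Prop :=
  (tstar < 0)%E ->
  Cn n history Phi /\ forall k : 'I_n, vderivn history k Phi 0 = v k.

Definition past_jet (Tend : R) (u : R -> 'cV[R]_p) k (s : R) : 'M[R]_(p, k) :=
  if 0 <= s then jet `[0, Tend] k u s else jet history k Phi s.

Definition delayed_block (Tend : R) (u : R -> 'cV[R]_p) (t : R) :
    'M[R]_(p, \sum_(i < r) (m i).+1) :=
  \mxrow_(i < r) past_jet Tend u (m i).+1 (alpha i t).

(* The equation is imposed at every t in [0, Tend] whose delayed arguments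
   stay in the domain of the solution.  This is automatic for t > 0, and can
   fail only at t = 0 for a time-dependent delay, which is unconstrained
   there.                                                                     *)
Definition solution (Tend : R) (u : R -> 'cV[R]_p) : Prop :=
  [/\ Cn n `[0, Tend] u,
      (forall k : 'I_n, vderivn `[0, Tend] k u 0 = v k),
      ((tstar < 0)%E -> forall s, history s -> u s = Phi s)
    & forall t, 0 <= t <= Tend ->
        (forall i, (tstar <= (alpha i t)%:E)%E /\ alpha i t <= Tend) ->
        vderivn `[0, Tend] n u t =
        f t (jet `[0, Tend] n u t) (delayed_block Tend u t)].

Definition unique_solution (Tend : R) (u : R -> 'cV[R]_p) : Prop :=
  solution Tend u /\
  forall w, solution Tend w -> forall t, 0 <= t <= Tend -> w t = u t.

End Data.
End Problem.

Definition diff_transform {R : realType} {p : nat} (gamma : R)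
    (u : R -> 'cV[R]_p) (k : nat) : 'cV[R]_p :=
  (k`!%:R)^-1 *: vderivn `[0, gamma] k u 0.

(* Main.v *)
Require Import Defs.
From mathcomp Require Import ring lra.

(** The hypothesis on the norms gives |U_i(k)| gamma^k = O(delta^k), so the
    Taylor series of u at 0 has radius of convergence at least gamma / delta,
    which exceeds gamma.  Since u and this series are both analytic on
    [0, gamma] and agree near 0, they agree on all of [0, gamma].  The series
    can then be differentiated termwise, and the derivatives of its tail are
    bounded by the geometric series of the norms of the F_k. *)

Section PowerSeries.
Context {R : realType}.
Local Notation diffs := (@pseries_diffs R).
Implicit Types (a b c : nat -> R) (x y t rho gamma delta : R).

(** * Comparison and domination of real series *)

Lemma cvg_series_dominated (v w : nat -> R) : (forall k, `|v k| <= w k) ->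
  cvgn (series w) -> cvgn (series v).
Proof.
move=> vw cw; apply: normed_cvg; apply: (series_le_cvg _ _ vw cw) => k //.
exact: le_trans (normr_ge0 _) (vw k).
Qed.

Lemma ler_norm_lim_series (v w : nat -> R) : (forall k, `|v k| <= w k) ->
  cvgn (series w) -> `|limn (series v)| <= limn (series w).
Proof.
move=> vw cw.
have cv : cvgn [normed series v].
  by apply: cvg_series_dominated cw => k; rewrite normr_id.
by rewrite (le_trans (lim_series_norm cv))// lim_series_le.
Qed.

Lemma is_cvg_seriesS (v : nat -> R) :
  cvgn (series v) -> cvgn (series (fun k => v k.+1)).
Proof.
move=> cv.
have -> : series (fun k => v k.+1) = (fun n => series v n.+1 - v 0%N).
  by apply/funext => n; rewrite /series/= big_nat_recl// addrC addKr.
apply: is_cvgB; last exact: is_cvg_cst.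
by case/cvg_ex: cv => l cv; apply/cvg_ex; exists l; rewrite cvg_shiftS.
Qed.

(** * Power series inside their disc of convergence *)

Definition psum a x : R := limn (pseries a x).

(* [rho] is only a lower bound for the radius of convergence. *)
Definition cvg_radius a rho : Prop :=
  forall x, `|x| < rho -> cvgn (pseries a x).

(** Convergence at the midpoint [z] of |x| and [rho] gives absolute convergence at [x]. *)
Lemma cvg_radius_norm a rho x : cvg_radius a rho -> `|x| < rho ->
  cvgn (series (fun k => `|a k| * `|x| ^+ k)).
Proof.
move=> ca xr; have x0 := normr_ge0 x; pose z := (`|x| + rho) / 2.
have z0 : `|x| < `|z| by rewrite (lt_le_trans _ (ler_norm _))// /z; lra.
apply: (@is_cvg_pseries_inside_norm _ a z); last by rewrite normr_id.
by apply: ca; rewrite ger0_norm /z; lra.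
Qed.

Lemma cvg_radius_diffs a rho :
  cvg_radius a rho -> cvg_radius (diffs a) rho.
Proof.
move=> ca x xr; have x0 := normr_ge0 x; pose h := (rho - `|x|) / 2.
have h0 : 0 < h by rewrite /h; lra.
have xhE : `| `|x| + h | = `|x| + h by rewrite ger0_norm//; lra.
have xhr : `| `|x| + h | < rho by rewrite xhE /h; lra.
have /(@is_cvg_seriesZ _ _ h^-1) cw := is_cvg_seriesS (cvg_radius_norm ca xhr).
apply: (@cvg_series_dominated _
  (fun k => h^-1 * (`|a k.+1| * (`|x| + h) ^+ k.+1))) => [k|]; last first.
  by rewrite xhE in cw; exact: cw.
rewrite /pseries_diffs !normrM normrX normr_nat.
rewrite [leLHS](_ : _ =
  h^-1 * (`|a k.+1| * (k.+1%:R * `|x| ^+ k * h))); last first.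
  by field; rewrite gt_eqF.
apply: ler_wpM2l; first by rewrite invr_ge0 ltW.
(* (k + 1) |x|^k h is one of the terms in the expansion of (|x| + h)^(k + 1). *)
apply: ler_wpM2l => //; rewrite exprDn.
rewrite big_ord_recl big_ord_recl /= /bump/= subn0 subn1 bin0 bin1 expr0 expr1.
rewrite [leLHS](_ : _ = `|x| ^+ k * h *+ k.+1); last first.
  by rewrite -[RHS]mulr_natl mulrA.
rewrite addrCA lerDl addr_ge0// ?mulr1n ?mulr_ge0 ?exprn_ge0//.
apply: sumr_ge0 => i _.
by rewrite mulrn_wge0// mulr_ge0// exprn_ge0// ltW.
Qed.

Lemma cvg_radius_iter_diffs a rho j :
  cvg_radius a rho -> cvg_radius (iter j diffs a) rho.
Proof. by move=> ca; elim: j => //= j; exact: cvg_radius_diffs. Qed.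

Lemma psum0 a : psum a 0 = a 0%N.
Proof.
(* The partial sum of index 0 is empty; from index 1 on they all equal [a 0]. *)
apply: cvg_lim => //; rewrite -cvg_shiftS; apply: cvg_near_cst; near=> k.
rewrite /pseries/= /series/= big_nat_recl//= expr0 mulr1 big1 ?addr0// => i _.
by rewrite expr0n mulr0.
Unshelve. all: by end_near. Qed.

Lemma is_derive_psum a rho x : cvg_radius a rho -> `|x| < rho ->
  is_derive x (1 : R) (psum a) (psum (diffs a) x).
Proof.
move=> ca xr; have x0 := normr_ge0 x; pose z := (`|x| + rho) / 2.
have z0 : `|z| < rho by rewrite ger0_norm /z; lra.
(* Termwise differentiation asks that the series and its first two derived series converge at one
   point [z] with |x| < |z|. *)
apply: (@pseries_snd_diffs _ _ z); first exact: ca.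
- exact: cvg_radius_diffs z0.
- exact: (cvg_radius_diffs (cvg_radius_diffs ca)) z0.
by rewrite (lt_le_trans _ (ler_norm _))// /z; lra.
Qed.

Lemma continuous_psum a rho x : cvg_radius a rho -> `|x| < rho ->
  {for x, continuous (psum a)}.
Proof.
move=> ca xr; have [d _] := is_derive_psum ca xr.
exact/differentiable_continuous/derivable1_diffP.
Qed.

(** One-sided identity theorem: [a 0] is the limit of the sum at 0 from the left, and the derived
    series vanishes on the same interval, so induction reaches every coefficient. The left side is
    used because the continuation argument below knows the function only up to a current
    endpoint. *)
Lemma psum_eq0 a rho : 0 < rho -> cvg_radius a rho ->
  (forall x, - rho < x < 0 -> psum a x = 0) -> forall k, a k = 0.
Proof.
move=> r0 + + k; elim: k a => [|k IHk] a ca a0.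
  have := @continuous_psum a rho 0 ca; rewrite normr0 => /(_ r0) ca0.
  rewrite -psum0; have pa : psum a x @[x --> 0^'-] --> psum a 0.
    exact: cvg_at_left_filter.
  rewrite -(cvg_lim (@Rhausdorff R) pa); apply: cvg_lim => //.
  apply: cvg_near_cst; near=> x.
  apply: a0; apply/andP; split; near: x.
    by apply: nbhs_left_gt; lra.
  exact: nbhs_left_lt.
suff : diffs a k = 0.
  move=> /eqP; rewrite /pseries_diffs mulf_eq0 pnatr_eq0/=.
  by move/eqP.
apply: IHk; first exact: cvg_radius_diffs.
move=> x /andP[x1 x0]; have xr : `|x| < rho by rewrite ltr0_norm//; lra.
have [_ <-] := is_derive_psum ca xr.
rewrite (@near_eq_derive _ _ _ _ (cst 0))// ?derive_cst//.
near=> y; apply: a0; apply/andP; split; near: y.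
  exact: lt_nbhsr.
exact: lt_nbhsl.
Unshelve. all: by end_near. Qed.

(** * Exchange of summations and recentring of a power series *)

Lemma cvg_series_tail (w : nat -> R) N : cvgn (series w) ->
  series (fun k => if (k < N)%N then 0 else w k) @ \oo -->
    limn (series w) - series w N.
Proof.
move=> cw; apply: (@cvg_trans _ ((series w n - series w N) @[n --> \oo])).
  apply: near_eq_cvg; near=> n.
  have Nn : (N <= n)%N by near: n; exact: nbhs_infty_ge.
  rewrite sub_series_geq// /series/=.
  rewrite [in RHS](big_cat_nat (n := N))//= [X in _ = X + _]big_nat_cond.
  rewrite [X in _ = X + _]big1 ?add0r.
    by apply: eq_big_nat => k /andP[Nk _]; rewrite ltnNge Nk.
  by move=> k /andP[/andP[_ ->]].
by apply: cvgB => //; exact: cvg_cst.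
Unshelve. all: by end_near. Qed.

(** The row-wise majorant [w] makes the array absolutely summable, so summing by columns gives the
    same total as summing the finite rows. *)
Lemma series_triangular_swap (x : nat -> nat -> R) (w : nat -> R) :
  (forall m, \sum_(0 <= k < m.+1) `|x m k| <= w m) ->
  (forall m k, (m < k)%N -> x m k = 0) ->
  cvgn (series w) ->
  series (fun k => limn (series (x^~ k))) @ \oo -->
    limn (series (fun m => \sum_(0 <= k < m.+1) x m k)).
Proof.
move=> xw x0 cw.
(* Entries above the diagonal vanish, so the bound holds for any number [K] of columns. *)
have {}xw K m : \sum_(0 <= k < K) `|x m k| <= w m.
  apply: le_trans (xw m); have [Km|/ltnW mK] := leqP K m.+1.
    by rewrite [leRHS](big_cat_nat (n := K))//= lerDl sumr_ge0.
  rewrite (big_cat_nat (n := m.+1))//= [X in _ + X]big_nat_cond.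
  rewrite [X in _ + X]big1 ?addr0// => k /andP[/andP[mk _] _].
  by rewrite x0 ?normr0.
have cx k : cvgn (series (x^~ k)).
  apply: cvg_series_dominated cw => m.
  by apply: le_trans (xw k.+1 m); rewrite big_nat_recr//= lerDr sumr_ge0.
have cX K : cvgn (series (fun m => \sum_(0 <= k < K) x m k)).
  apply: cvg_series_dominated cw => m.
  by apply: le_trans (xw K m); exact: ler_norm_sum.
(* Finitely many columns can be added inside the limit over rows. *)
have XE K : series (fun k => limn (series (x^~ k))) K =
    limn (series (fun m => \sum_(0 <= k < K) x m k)).
  elim: K => [|K IHK].
    rewrite /series/= big_nil; apply/esym/cvg_lim => //.
    by apply: cvg_near_cst; near=> n; apply: big1 => i _; rewrite big_nil.
  rewrite seriesSr IHK -lim_seriesD//.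
  congr (limn (series _)); apply/funext => m.
  by rewrite [RHS]big_nat_recr.
have cY : cvgn (series (fun m => \sum_(0 <= k < m.+1) x m k)).
  apply: cvg_series_dominated cw => m.
  by apply: le_trans (xw m.+1 m); exact: ler_norm_sum.
apply/cvgrPdist_lt => e e0; near=> K.
apply: (@le_lt_trans _ _ (limn (series w) - series w K)); last first.
  rewrite (le_lt_trans (ler_norm _))//; near: K.
  by move/cvgrPdist_lt : cw; exact.
(* The double series and the sum of its first K columns have the same rows
   m < K, so their difference is dominated by the tail of the series of w. *)
rewrite XE -lim_seriesB//.
rewrite -(cvg_lim (@Rhausdorff R) (cvg_series_tail (N := K) cw)).
apply: ler_norm_lim_series; last exact: cvgP (cvg_series_tail (N := K) cw).
move=> m /=; case: ltnP => mK.
  rewrite (_ : (_ - _) m = 0) ?normr0//; apply/eqP; rewrite subr_eq0; apply/eqP.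
  rewrite [RHS](big_cat_nat (n := m.+1))//= [X in _ + X]big_nat_cond.
  by rewrite [X in _ + X]big1 ?addr0// => k /andP[/andP[mk _] _]; rewrite x0.
rewrite (_ : (_ - _) m = \sum_(K <= k < m.+1) x m k); last first.
  apply/eqP; rewrite subr_eq addrC; apply/eqP.
  by rewrite [LHS](big_cat_nat (n := K))// ltnW.
rewrite (le_trans (ler_norm_sum _ _ _))// (le_trans _ (xw m.+1 m))//.
by rewrite [leRHS](big_cat_nat (n := K))//= ?lerDr ?sumr_ge0// ltnW.
Unshelve. all: by end_near. Qed.

(** Expand [a m * (t + y) ^+ m] by the binomial formula and collect powers of [y]; the triangular
    exchange applies with majorant |a m| (|t| + |y|)^m. *)
Lemma psum_recenter a rho t : cvg_radius a rho -> `|t| < rho ->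
  exists b, forall y, `|y| < rho - `|t| ->
    series (fun k => b k * y ^+ k) @ \oo --> psum a (t + y).
Proof.
move=> ca tr; have t0 := normr_ge0 t.
pose b k := limn (series (fun m => a m * t ^+ (m - k) *+ 'C(m, k))).
have cb k : cvgn (series (fun m => a m * t ^+ (m - k) *+ 'C(m, k))).
  (* With [h] half the gap to [rho], C(m, k) |t|^(m - k) h^k is one term of the expansion of (|t| +
     h)^m. *)
  pose h := (rho - `|t|) / 2; have h0 : 0 < h by rewrite /h; lra.
  have := @cvg_radius_norm _ _ (`|t| + h) ca.
  rewrite ger0_norm; last by lra.
  move=> /(_ _)/wrap[]; first by rewrite /h; lra.
  move=> /(@is_cvg_seriesZ _ _ (h ^- k)); apply: cvg_series_dominated => m.
  rewrite -[leRHS]/(h ^- k * (`|a m| * (`|t| + h) ^+ m)) [leRHS]mulrC.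
  rewrite ler_pdivlMr ?exprn_gt0// normrMn normrM normrX.
  have [mk|km] := ltnP m k.
    by rewrite bin_small// mulr0n mul0r mulr_ge0// exprn_ge0//; lra.
  rewrite -mulrnAr -mulrA ler_wpM2l// exprDn.
  have km1 : (k < m.+1)%N by [].
  rewrite (bigD1 (Ordinal km1))//= mulrnAl lerDl sumr_ge0// => i _.
  by rewrite mulrn_wge0// mulr_ge0// exprn_ge0// ltW.
exists b => y yr; have y0 := normr_ge0 y.
pose w m := `|a m| * (`|t| + `|y|) ^+ m.
pose x m k := a m * (t ^+ (m - k) * y ^+ k *+ 'C(m, k)).
have xw m : \sum_(0 <= k < m.+1) `|x m k| <= w m.
  rewrite /w exprDn mulr_sumr big_mkord ler_sum// => k _.
  by rewrite normrM normrMn normrM !normrX.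
have x0 m k : (m < k)%N -> x m k = 0.
  by move=> mk; rewrite /x bin_small// mulr0n mulr0.
have cw : cvgn (series w).
  have := @cvg_radius_norm _ _ (`|t| + `|y|) ca.
  by rewrite ger0_norm ?addr_ge0//; apply; lra.
have := series_triangular_swap xw x0 cw.
rewrite (_ : (fun m => \sum_(0 <= k < m.+1) x m k) =
             (fun m => a m * (t + y) ^+ m)); last first.
  by apply/funext => m; rewrite exprDn mulr_sumr big_mkord.
rewrite (_ : (fun k => limn (series (x^~ k))) = (fun k => b k * y ^+ k))//.
apply/funext => k; rewrite mulrC -[RHS]lim_seriesZ//.
congr (limn (series _)); apply/funext => m.
rewrite -[RHS]/(y ^+ k * (a m * t ^+ (m - k) *+ 'C(m, k))) /x.
by rewrite !mulrnAr mulrA [in RHS]mulrC.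
Qed.

(** * Formal derivatives and continuation along [0, gamma] *)

Lemma iter_diffsE a j k :
  iter j diffs a k = ((k + j) ^_ j)%:R * a (k + j)%N.
Proof.
elim: j k => [|j IHj] k; first by rewrite addn0 ffactn0 mul1r.
rewrite iterS /pseries_diffs IHj addSnnS mulrA -natrM ffactnSr.
by rewrite addnS -addSn addnK mulnC.
Qed.

(** Continuation argument: let [s0] be the supremum of the points up to which [h] and the sum agree.
    The expansion of [h] at [s0] and the recentred series agree to the left of [s0], hence have
    equal coefficients, and agreement extends past [s0] unless it already covers [0, gamma]. *)
Lemma analytic1_psum gamma (h : R -> R) a rho eps :
  gamma < rho -> analytic1 `[0, gamma] h -> cvg_radius a rho -> 0 < eps ->
  (forall t, 0 <= t <= gamma -> t < eps -> h t = psum a t) ->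
  forall t, 0 <= t <= gamma -> h t = psum a t.
Proof.
move=> gr hh ca e0 ha.
have [g0|g0] := leP gamma 0.
  by move=> t t0; apply: ha => //; lra.
pose E := [set s | 0 <= s <= gamma /\ forall t, 0 <= t <= s -> h t = psum a t].
have E1 : E (Num.min gamma (eps / 2)).
  have m1 : Num.min gamma (eps / 2) <= gamma by rewrite ge_min lexx.
  have m2 : Num.min gamma (eps / 2) <= eps / 2 by rewrite ge_min lexx orbT.
  split; first by rewrite m1 andbT le_min; lra.
  by move=> t t0; apply: ha; lra.
have Eg : ubound E gamma by move=> s []; lra.
have Esup : has_sup E by split; [exists (Num.min gamma (eps / 2))|exists gamma].
have [s0 s0E] : exists s, s = sup E by exists (sup E).
have s00 : 0 < s0.
  apply: (@lt_le_trans _ _ (Num.min gamma (eps / 2))); first by rewrite lt_min; lra.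
  by rewrite s0E; apply: ub_le_sup => //; case: Esup.
have s0g : s0 <= gamma by rewrite s0E; apply: ge_sup => //; case: Esup.
have Elt t : 0 <= t < s0 -> h t = psum a t.
  move=> /andP[t0 ts]; have /(sup_adherent)/(_ Esup)[s Es] : 0 < s0 - t by lra.
  by rewrite -s0E => ts'; apply: Es.2; lra.
have [|c [r r0 hc]] := hh s0; first by rewrite /= in_itv/=; lra.
have [|b hb] := @psum_recenter a rho s0 ca; first by rewrite gtr0_norm//; lra.
rewrite gtr0_norm// in hb.
(* Within [e] of [s0] both expansions apply, and points to the left of [s0] remain in [0, gamma]. *)
pose e := Num.min (Num.min r (rho - s0)) s0.
have [[er ers] es0] : (e <= r /\ e <= rho - s0) /\ e <= s0.
  by rewrite /e !ge_min !lexx !orbT.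
have {}e0 : 0 < e by rewrite /e !lt_min r0 s00 subr_gt0 (le_lt_trans s0g gr).
have hcy y : - e < y <= 0 -> series (fun k => c k * y ^+ k) @ \oo --> h (s0 + y).
  move=> ye; have := hc (s0 + y); rewrite (addrC s0) addrK addrC; apply.
    by rewrite /= in_itv/=; lra.
  by rewrite ler0_norm; lra.
have cc : cvg_radius c e.
  (* [z] is negative so that [s0 + z] stays in the domain even when [s0 = gamma]; convergence there
     covers both signs of [x]. *)
  move=> x xe; have x0 := normr_ge0 x; pose z := - ((`|x| + e) / 2).
  apply: (@is_cvg_pseries_inside _ _ z); last by rewrite [ltRHS]ler0_norm /z; lra.
  by apply/cvgP/hcy; rewrite /z; lra.
have cb : cvg_radius b e by move=> y ye; apply/cvgP/hb; lra.
have cbE : c = b.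
  apply/funext => k; apply/eqP; rewrite -subr_eq0; apply/eqP; move: k.
  have pE x : pseries (fun k => c k - b k) x = pseries c x - pseries b x.
    rewrite /pseries -[RHS]/(_ + _) -seriesN -seriesD; congr series.
    by apply/funext => k /=; rewrite mulrBl.
  apply: (@psum_eq0 _ e) => // x xe.
    by rewrite pE; apply: is_cvgB; [exact: cc|exact: cb].
  have xe' : `|x| < e by rewrite ltr0_norm; lra.
  rewrite /psum pE limB; [|exact: cc|exact: cb].
  rewrite (cvg_lim _ (hcy x _))//; last by lra.
  by rewrite (cvg_lim _ (hb x _))// ?Elt ?subrr//; lra.
have hnear t : 0 <= t <= gamma -> `|t - s0| < e -> h t = psum a t.
  move=> tg te; have h1 : `|t - s0| < rho - s0 by lra.
  have := hb _ h1; rewrite -cbE [s0 + _]addrC subrK => /(cvg_lim (@Rhausdorff R)) <-.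
  apply/esym/cvg_lim => //; apply: hc; last lra.
  by rewrite /= in_itv.
have hall t : 0 <= t <= gamma -> t < s0 + e -> h t = psum a t.
  move=> tg te; have [ts|ts] := ltP t s0; first by apply: Elt; lra.
  by apply: hnear => //; rewrite ger0_norm; lra.
(* Otherwise [s0 + e / 2] would belong to [E] and exceed its supremum. *)
suff gs : gamma < s0 + e by move=> t tg; apply: hall => //; lra.
rewrite ltNge; apply/negP => gs.
suff : s0 + e / 2 <= s0 by lra.
rewrite [leRHS]s0E; apply: ub_le_sup; first by case: Esup.
by split=> [|t tg]; [|apply: hall]; lra.
Qed.

(** * Derivatives relative to [0, gamma] *)

Lemma itv_dnbhs_proper gamma t : 0 < gamma -> 0 <= t <= gamma ->
  ProperFilter (within `[0, gamma] t^').
Proof.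
move=> g0 tg; apply: Build_ProperFilter_ex.
move=> P /= [e /= e0 Pe].
(* The nearby point is taken to the right of [t], or to the left when [t] is the endpoint
   [gamma]. *)
have [tl|tr] := ltP t gamma.
  exists (Num.min (t + e / 2) gamma).
  have m1 : Num.min (t + e / 2) gamma <= t + e / 2 by rewrite ge_min lexx.
  have m2 : Num.min (t + e / 2) gamma <= gamma by rewrite ge_min lexx orbT.
  have m3 : t < Num.min (t + e / 2) gamma by rewrite lt_min; lra.
  apply: Pe; last by rewrite /= in_itv/=; lra.
    by rewrite /ball/= ltr0_norm; lra.
  by rewrite gt_eqF.
exists (Num.max (t - e / 2) 0).
have m1 : t - e / 2 <= Num.max (t - e / 2) 0 by rewrite le_max lexx.
have m2 : 0 <= Num.max (t - e / 2) 0 by rewrite le_max lexx orbT.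
have m3 : Num.max (t - e / 2) 0 < t by rewrite gt_max; lra.
apply: Pe; last by rewrite /= in_itv/=; lra.
  by rewrite /ball/= gtr0_norm; lra.
by rewrite lt_eqF.
Qed.

(** Caratheodory's factorisation g s - g t = q s (s - t), with [q] continuous at [t], turns the
    difference quotient of [h] into [q], also at an endpoint where only one side is available. *)
Lemma deriv_in_itv gamma (h g : R -> R) t d rho :
  0 < gamma -> 0 <= t <= gamma -> t < rho -> is_derive t 1 g d ->
  (forall s, 0 <= s <= gamma -> s < rho -> h s = g s) ->
  deriv_in `[0, gamma] h t = d.
Proof.
move=> g0 tg tr /is_derive1_caratheodory[q [gq qc <-]] hg.
have pF := itv_dnbhs_proper g0 tg.
apply: cvg_lim => //; apply: (@cvg_trans _ (q s @[s --> within `[0, gamma] t^'])).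
  apply: near_eq_cvg; near=> s.
  have sD : 0 <= s <= gamma.
    near: s; apply: filterS (withinT _ _) => s /=; by rewrite in_itv.
  have st : s != t by near: s; apply: cvg_within; exact: withinT.
  have sr : s < rho.
    by near: s; apply: cvg_within; apply: nbhs_dnbhs; exact: lt_nbhsl.
  by rewrite /diff_quot !hg// gq mulfK// subr_eq0.
apply: cvg_trans qc; apply: cvg_app; apply: cvg_trans (@nbhs_dnbhs _ t).
exact: cvg_within.
Unshelve. all: by end_near. Qed.

(** Agreement is required only below [rho], so this serves both on all of [0, gamma] and near 0,
    where only a local expansion is known. *)
Lemma derivn_in_psum gamma (h : R -> R) a rho j t :
  0 < gamma -> cvg_radius a rho ->
  (forall s, 0 <= s <= gamma -> s < rho -> h s = psum a s) ->
  0 <= t <= gamma -> t < rho ->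
  derivn_in `[0, gamma] j h t = psum (iter j diffs a) t.
Proof.
move=> g0 ca ha; elim: j t => [|j IHj] t tg tr; first exact: ha.
apply: (deriv_in_itv g0 tg tr _ IHj).
apply: (is_derive_psum (rho := rho)); first exact: cvg_radius_iter_diffs.
by rewrite ger0_norm//; case/andP: tg.
Qed.

Lemma derivn_in_monomial gamma (c : R) k j t : 0 < gamma -> 0 <= t <= gamma ->
  derivn_in `[0, gamma] j (fun s => s ^+ k * c) t =
  (k ^_ j)%:R * c * t ^+ (k - j).
Proof.
move=> g0; elim: j t => [|j IHj] t tg.
  by rewrite ffactn0 mul1r subn0 mulrC.
(* Any [rho] above [gamma] works, since the two functions agree on the whole interval. *)
apply: (deriv_in_itv (rho := gamma + 1)
  (g := fun s => (k ^_ j)%:R * c * s ^+ (k - j)) g0 tg) => //; first by lra.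
  have dX : is_derive t (1 : R) (@GRing.exp R ^~ (k - j)%N)
      ((k - j)%:R * t ^+ (k - j).-1).
    by apply: DeriveDef; [exact: exprn_derivable|rewrite exp_derive scaler1].
  apply: (is_derive_eq (@is_deriveZ _ _ _ _ ((k ^_ j)%:R * c) _ _ _ dX)).
  by rewrite ffactnSr natrM subnS -[LHS]/(_ * _); ring.
by move=> s sg _; exact: IHj.
Qed.

(** The power t^(k - j) is nondecreasing on [0, gamma], so the supremum is attained at [gamma]. *)
Lemma sup_norm_monomial gamma (c : R) k j : 0 < gamma ->
  sup [set `|derivn_in `[0, gamma] j (fun s => s ^+ k * c) t|
    | t in `[0, gamma]] =
  `|(k ^_ j)%:R * c * gamma ^+ (k - j)|.
Proof.
move=> g0; have gg : 0 <= gamma <= gamma by rewrite lexx ltW.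
have ub : ubound [set `|derivn_in `[0, gamma] j (fun s => s ^+ k * c) t|
    | t in `[0, gamma]] `|(k ^_ j)%:R * c * gamma ^+ (k - j)|.
  move=> _ [t + <-]; rewrite /= in_itv/= => tg.
  rewrite derivn_in_monomial// !normrM ler_wpM2l//.
  rewrite !normrX lerXn2r ?nnegrE ?normr_ge0//.
  by rewrite ger0_norm ?(gtr0_norm g0); case/andP: tg.
apply/eqP; rewrite eq_le; apply/andP; split.
  by apply: (ge_sup _ ub); apply: image_nonempty; exists gamma; rewrite /= in_itv.
apply: ub_le_sup; first by eexists; exact: ub.
by exists gamma; rewrite /= ?in_itv//= derivn_in_monomial.
Qed.

(** * The norm of C^n and the remainder of a power series *)

Lemma Cn_norm_monomial n p gamma k (V : 'cV[R]_p) : 0 < gamma ->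
  Cn_norm n `[0, gamma] (fun t => t ^+ k *: V) =
  \big[Num.max/0]_(i < p) \big[Num.max/0]_(j < n.+1)
    `|(k ^_ j)%:R * V i ord0 * gamma ^+ (k - j)|.
Proof.
move=> g0; apply: eq_bigr => i _; apply: eq_bigr => j _.
rewrite -sup_norm_monomial// (_ : cmp _ i = fun t => t ^+ k * V i ord0)//.
by apply/funext => t; rewrite /cmp mxE.
Qed.

Lemma Cn_norm_le n p gamma (w : R -> 'cV[R]_p) (B : R) : 0 <= gamma -> 0 <= B ->
  (forall i j t, (j <= n)%N -> 0 <= t <= gamma ->
    `|derivn_in `[0, gamma] j (cmp w i) t| <= B) ->
  Cn_norm n `[0, gamma] w <= B.
Proof.
move=> g0 B0 wB; apply: bigmax_le => // i _; apply: bigmax_le => // j _.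
apply: ge_sup; first by apply: image_nonempty; exists 0; rewrite /= in_itv/= lexx.
by move=> _ [t + <-]; rewrite /= in_itv/=; apply: wB; rewrite -ltnS.
Qed.

Lemma norm_lim_series_le (v : nat -> R) (B : R) : cvgn (series v) ->
  (forall n, \sum_(0 <= k < n) `|v k| <= B) -> `|limn (series v)| <= B.
Proof.
move=> cv vB; rewrite -lim_norm//; apply: limr_le; first exact: is_cvg_norm.
by near=> n; apply: le_trans (vB n); exact: ler_norm_sum.
Unshelve. all: by end_near. Qed.

(** The remainder is the power series with its first [K] coefficients set to 0, so it is
    differentiated termwise; the modulus of each term is at most its value at [gamma], which the
    hypothesis bounds by a geometric sequence of sum [C / (1 - delta)]. *)
Lemma taylor_remainder_le gamma rho (h : R -> R) a j K C delta t :
  0 < gamma -> gamma < rho -> cvg_radius a rho ->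
  (forall s, 0 <= s <= gamma -> h s = psum a s) ->
  0 <= C -> 0 < delta < 1 ->
  (forall l, (K <= l)%N ->
    `|(l ^_ j)%:R * a l * gamma ^+ (l - j)| <= C * delta ^+ (l - K)) ->
  0 <= t <= gamma ->
  `|derivn_in `[0, gamma] j (fun s => h s - \sum_(0 <= k < K) s ^+ k * a k) t|
    <= C / (1 - delta).
Proof.
move=> g0 gr ca ha C0 /andP[d0 d1] aC tg.
pose a' l := if (l < K)%N then 0 else a l.
have ca' : cvg_radius a' rho.
  move=> x xr; apply: cvg_series_dominated (cvg_radius_norm ca xr) => k.
  rewrite normrM normrX /a'; case: ifP => // _.
  by rewrite normr0 mul0r mulr_ge0// exprn_ge0.
have ha' s : 0 <= s <= gamma -> s < rho ->
    h s - \sum_(0 <= k < K) s ^+ k * a k = psum a' s.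
  move=> sg sr; apply/esym/cvg_lim => //; rewrite ha//.
  have sr' : `|s| < rho by rewrite ger0_norm//; case/andP: sg.
  have := cvg_series_tail (N := K) (ca _ sr').
  rewrite (_ : (fun k => if _ then _ else _) = (fun k => a' k * s ^+ k)); last first.
    by apply/funext => k; rewrite /a'; case: ifP; rewrite ?mul0r.
  rewrite (_ : series _ K = \sum_(0 <= k < K) s ^+ k * a k)//.
  by apply: eq_bigr => k _; rewrite mulrC.
rewrite (derivn_in_psum _ g0 ca' ha' tg); last by lra.
have tr : `|t| < rho by rewrite ger0_norm; lra.
apply: norm_lim_series_le.
  exact: (@cvg_radius_iter_diffs a' rho j ca' t tr).
move=> n; pose w l := if (l < K)%N then 0 else C * delta ^+ (l - K).
have w0 l : 0 <= w l.
  by rewrite /w; case: ifP => // _; rewrite mulr_ge0// exprn_ge0// ltW.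
(* Term [l] of the [j]-th derived series carries the coefficient of index [l + j], whence the
   shift. *)
apply: (@le_trans _ _ (\sum_(0 <= l < n) w (l + j)%N)).
  apply: ler_sum => l _; rewrite /= iter_diffsE /a' /w; case: ltnP => lK.
    by rewrite mulr0 mul0r normr0.
  apply: le_trans (aC _ lK); rewrite !normrM ler_wpM2l// addnK.
  rewrite !normrX lerXn2r ?nnegrE ?normr_ge0//.
  by rewrite ger0_norm ?(gtr0_norm g0); case/andP: tg.
have -> : \sum_(0 <= l < n) w (l + j)%N = \sum_(j <= l < n + j) w l.
  by rewrite -{2}[j]add0n big_addn addnK.
(* The range is enlarged so that it can be split at [K] whatever the size of [n + j]. *)
apply: (@le_trans _ _ (\sum_(0 <= l < K + (n + j)) w l)).
  apply: (@le_trans _ _ (\sum_(0 <= l < n + j) w l)).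
    by rewrite [leRHS](big_cat_nat (n := j)) ?leq_addl//= lerDr sumr_ge0.
  by rewrite [leRHS](big_cat_nat (n := n + j)%N) ?leq_addl//= lerDl sumr_ge0.
rewrite (big_cat_nat (n := K)) ?leq_addr//= big_nat_cond big1 ?add0r; last first.
  by move=> l /andP[/andP[_ lK] _]; rewrite /w lK.
apply: le_trans (geometric_le_lim (n + j) C0 d0 _); last by rewrite gtr0_norm.
rewrite -{1}[K]add0n big_addn addKn; apply: ler_sum => l _.
by rewrite /w ltnNge leq_addl/= addnK.
Qed.

End PowerSeries.

(** * Taylor expansion on [0, gamma] and the error estimate *)

Lemma analytic1_taylor (R : realType) (gamma rho : R) (h : R -> R) (a : nat -> R) :
  0 < gamma -> gamma < rho -> analytic1 `[0, gamma] h -> cvg_radius a rho ->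
  (forall k, a k = (k`!%:R)^-1 * derivn_in `[0, gamma] k h 0) ->
  forall t, 0 <= t <= gamma -> h t = psum a t.
Proof.
move=> g0 gr hh ca aE.
have D0 : 0 <= (0 : R) <= gamma by lra.
have [|c [r r0 hc]] := hh 0; first by rewrite /= in_itv.
pose e := Num.min r gamma.
have [er eg] : e <= r /\ e <= gamma by rewrite /e !ge_min !lexx orbT.
have e0 : 0 < e by rewrite /e lt_min r0.
have {}hc t : 0 <= t <= gamma -> t < e -> pseries c t @ \oo --> h t.
  move=> tg te; have := hc t; rewrite /= in_itv/= subr0; apply => //.
  by rewrite ger0_norm; lra.
have cc : cvg_radius c e.
  move=> x xe; have x0 := normr_ge0 x; pose z := (`|x| + e) / 2.
  apply: (@is_cvg_pseries_inside _ _ z); last by rewrite [ltRHS]ger0_norm /z; lra.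
  by apply/cvgP/hc; rewrite /z; lra.
have hE t : 0 <= t <= gamma -> t < e -> h t = psum c t.
  by move=> tg te; apply/esym/cvg_lim => //; exact: hc.
(* Differentiating the local expansion at 0 identifies its coefficients with the Taylor
   coefficients, so [h] agrees with [psum a] near 0. *)
have ca' : c = a.
  apply/funext => k; rewrite aE (derivn_in_psum _ g0 cc hE D0 e0) psum0.
  by rewrite iter_diffsE add0n ffactnn mulKf// pnatr_eq0 -lt0n fact_gt0.
by apply: (analytic1_psum gr hh ca e0); rewrite -ca'.
Qed.

Theorem theorem2 (R : realType) (n p r : nat) (m : 'I_r -> nat)
  (f : rhs m) (alpha : 'I_r -> R -> R)
  (v : 'I_n -> 'cV[R]_p) (Phi : R -> 'cV[R]_p)
  (Tstar gamma : R) (u : R -> 'cV[R]_p)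
  (U : nat -> 'cV[R]_p) (F : nat -> R -> 'cV[R]_p)
  (delta : R) (k0 : nat) :
  (0 < n)%N -> (0 < p)%N -> (0 < r)%N ->
  (forall i, (m i <= n)%N) ->
  rhs_continuous f ->
  (forall i, delayed_argument (alpha i)) ->
  initial_function alpha v Phi ->
  0 < Tstar ->
  rhs_analytic f Tstar ->
  unique_solution f alpha v Phi Tstar u ->
  0 < gamma <= Tstar ->
  analytic `[0, gamma] u ->
  (forall k, U k = diff_transform gamma u k) ->
  (forall k t, F k t = t ^+ k *: U k) ->
  0 < delta < 1 ->
  (forall k, (k0 <= k)%N ->
    Cn_norm n `[0, gamma] (F k.+1) <= delta * Cn_norm n `[0, gamma] (F k)) ->
  forall m0 M : nat, (k0 <= m0)%N -> (m0 <= M)%N ->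
  Cn_norm n `[0, gamma] (fun t => u t - \sum_(0 <= k < M.+1) F k t) <=
  (1 - delta)^-1 * delta ^+ (M - m0).+1 *
  \big[Num.max/0]_(i < p) \big[Num.max/0]_(j < n.+1)
    (if (j <= m0)%N
     then `|m0`!%:R / (m0 - j)`!%:R * U m0 i ord0 * gamma ^+ (m0 - j)|
     else 0).
Proof.
move=> _ _ _ _ _ _ _ _ _ _ /andP[g0 _] ua UE FE d01 NF m0 M km0 mM.
have [d0 d1] := andP d01.
pose N k := \big[Num.max/0]_(i < p) \big[Num.max/0]_(j < n.+1)
    `|(k ^_ j)%:R * U k i ord0 * gamma ^+ (k - j)|.
have FN k : Cn_norm n `[0, gamma] (F k) = N k.
  by rewrite /N -Cn_norm_monomial//; congr Cn_norm; apply/funext => t; rewrite FE.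
have N0 k : 0 <= N k by exact: bigmax_ge_id.
have leN k i j : (j <= n)%N ->
    `|(k ^_ j)%:R * U k i ord0 * gamma ^+ (k - j)| <= N k.
  rewrite -ltnS => jn; apply: le_trans (le_bigmax _ _ i).
  exact: (le_bigmax _ (fun j : 'I_n.+1 =>
    `|(k ^_ j)%:R * U k i ord0 * gamma ^+ (k - j)|) (Ordinal jn)).
(* Since [k0 <= m0], the ratio bound holds at every index from [m0] on; for smaller [m0], [N m0]
   could vanish while later norms do not. *)
have Ngeo k : (m0 <= k)%N -> N k <= N m0 * delta ^+ (k - m0).
  move=> mk; rewrite -(subnK mk) addnK; elim: (k - m0)%N => [|l IHl].
    by rewrite expr0 mulr1.
  rewrite addSn -FN (le_trans (NF _ _)) ?(leq_trans km0) ?leq_addl//.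
  by rewrite FN exprS mulrCA ler_wpM2l// ltW.
have -> : \big[Num.max/0]_(i < p) \big[Num.max/0]_(j < n.+1)
    (if (j <= m0)%N
     then `|m0`!%:R / (m0 - j)`!%:R * U m0 i ord0 * gamma ^+ (m0 - j)|
     else 0) = N m0.
  (* The quotient of factorials is the falling factorial, which vanishes for [j > m0] in agreement
     with the convention. *)
  apply: eq_bigr => i _; apply: eq_bigr => j _; case: leqP => jm.
    by rewrite -(ffact_fact jm) natrM mulfK// pnatr_eq0 -lt0n fact_gt0.
  by rewrite ffact_small// !mul0r normr0.
pose rho := gamma / delta.
have gr : gamma < rho by rewrite /rho ltr_pdivlMr// gtr_pMr.
pose a i k := U k i ord0.
have ca i : cvg_radius (a i) rho.
  move=> x; rewrite /rho ltr_pdivlMr// => xr.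
  (* Indices up to [m0] are bounded through their own summand of [C], the later ones through the
     summand of [m0]. *)
  pose C := \sum_(l < m0.+1) N l / delta ^+ l.
  have dl l : 0 < delta ^+ l by rewrite exprn_gt0.
  have NC k : N k <= C * delta ^+ k.
    have CN l : (l <= m0)%N -> N l / delta ^+ l <= C.
      rewrite -ltnS => lm; rewrite /C (bigD1 (Ordinal lm))//= lerDl sumr_ge0// => j _.
      by rewrite divr_ge0// ltW.
    have [km|mk] := leqP k m0; first by rewrite -ler_pdivrMr// CN.
    rewrite (le_trans (Ngeo _ (ltnW mk)))// -ler_pdivrMr// (le_trans _ (CN m0 _))//.
    by rewrite -mulrA ler_wpM2l// -{2}(subnK (ltnW mk)) exprD invfM mulVKf// gt_eqF.
  (* The case [j = 0] of [leN] bounds the coefficients; the ratio delta |x| / gamma is below 1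
     because |x| < gamma / delta. *)
  apply: (@cvg_series_dominated _ _ (geometric C (delta * `|x| / gamma))) => [k|].
    rewrite /= normrM normrX exprMn exprVn exprMn !mulrA ler_pdivlMr ?exprn_gt0//.
    rewrite mulrAC ler_wpM2r ?exprn_ge0// (le_trans _ (NC k))//.
    have := leN k i 0%N (leq0n n).
    by rewrite ffactn0 mul1r subn0 normrM [`|gamma ^+ _|]ger0_norm// exprn_ge0// ltW.
  apply: is_cvg_geometric_series.
  rewrite ger0_norm; first by rewrite ltr_pdivrMr// mul1r mulrC.
  by rewrite divr_ge0// ?mulr_ge0// ltW.
have ha i t : 0 <= t <= gamma -> cmp u i t = psum (a i) t.
  apply: (analytic1_taylor g0 gr (ua i) (ca i)) => k.
  by rewrite /a UE /diff_transform !mxE.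
have B0 : 0 <= N m0 * delta ^+ (M - m0).+1 by rewrite mulr_ge0// exprn_ge0// ltW.
rewrite [leRHS](_ : _ = N m0 * delta ^+ (M - m0).+1 / (1 - delta)); last by ring.
apply: Cn_norm_le; [exact: ltW|by rewrite divr_ge0//; lra|].
move=> i j t jn tg.
rewrite (_ : cmp _ i =
  fun s => cmp u i s - \sum_(0 <= k < M.+1) s ^+ k * a i k); last first.
  apply/funext => s; rewrite /cmp !mxE summxE; congr (_ - _).
  by apply: eq_bigr => k _; rewrite FE mxE.
(* Here [K = M.+1] and [C = N m0 * delta ^+ (M - m0).+1]; the geometric bound follows by splitting
   the exponent l - m0 as (M + 1 - m0) + (l - M - 1). *)
apply: (taylor_remainder_le g0 gr (ca i) (ha i) B0 d01 _ tg) => l Ml.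
rewrite (le_trans (leN _ _ _ jn))// (le_trans (Ngeo _ _))//.
  exact: leq_trans mM (ltnW Ml).
rewrite -mulrA -exprD -subSn// addnC addnBA ?subnK//.
exact: leqW.
Qed.
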